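(* Let $\epsilon>0$ be arbitrary. As $n\to\infty$, the number of parts of $100\%$ of strongly unimodal sequences of size $n$ lies in the interval $\sqrt n\left(2\frac{\sqrt6}{\pi}\log 2-\epsilon,\;2\frac{\sqrt6}{\pi}\log 2+\epsilon\right)$; that is, $$\lim_{n\to\infty}\frac{1}{d(n)}\cdot\#\left\{\lambda\in\mathscr{D}(n):\ \sqrt n\left(2\tfrac{\sqrt6}{\pi}\log 2-\epsilon\right)<s(\lambda)<\sqrt n\left(2\tfrac{\sqrt6}{\pi}\log 2+\epsilon\right)\right\}=1,$$ where $\mathscr{D}(n)$ is the set of strongly unimodal sequences of size $n$, $d(n)=\#\mathscr{D}(n)$, and $s(\lambda)$ denotes the number of parts of $\lambda$.
   Context: A strongly unimodal sequence of size $n$ is a finite sequence $\lambda=(\lambda_1,\dots,\lambda_s)$ of positive integers with $\sum_{j=1}^s\lambda_j=n$ such that for some $k$, $0<\lambda_1<\dots<\lambda_{k-1}<\lambda_k>\lambda_{k+1}>\dots>\lambda_s>0$. Its parts are $\lambda_1,\dots,\lambda_s$, so its number of parts is $s$. *)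

(* Defs.v *)
From HB Require Import structures.
From mathcomp Require Import all_boot all_order all_algebra.
From mathcomp Require Import finmap.
From mathcomp Require Import all_classical all_reals all_analysis.

Set Implicit Arguments.
Unset Strict Implicit.
Unset Printing Implicit Defensive.

Import Order.TTheory GRing.Theory Num.Theory.
Import numFieldNormedType.Exports.

Local Open Scope classical_set_scope.

(* The peak is the entry of 0-based index k: it ends the increasing run
   [take k.+1 l] and starts the decreasing run [drop k l]. Since k < size l,
   the empty sequence is excluded. *)
Definition strongly_unimodal (l : seq nat) : Prop :=
  all (ltn 0) l /\
  exists2 k, k < size l & sorted ltn (take k.+1 l) /\ sorted gtn (drop k l).

Definition unimodal_seqs (n : nat) : set (seq nat) :=
  [set l | strongly_unimodal l /\ sumn l = n].

(* [fset_set] maps infinite sets to the empty set, so the cardinals of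
   [fset_set] below are meaningful only thanks to this finiteness. *)
Lemma finite_unimodal_seqs (n : nat) : finite_set (unimodal_seqs n).
Proof.
pose f (t : n.-bseq 'I_n.+1) := [seq val i | i <- t].
apply: (@sub_finite_set _ _ (f @` setT)); last first.
  by apply: finite_image; exact: finite_finset.
move=> l [[l_gt0 _] sum_l] /=.
have size_l : size l <= n.
  rewrite -sum_l; elim: l l_gt0 {sum_l} => //= x l IHl /andP[x_gt0 /IHl].
  by move=> le_l; rewrite -add1n leq_add.
have le_n : all (fun x => x < n.+1) l.
  rewrite -sum_l; elim: l {l_gt0 sum_l size_l} => //= x l IHl.
  rewrite ltnS leq_addr /=; apply: sub_all IHl => y.
  by rewrite !ltnS => /leq_trans; apply; exact: leq_addl.
have sz : size [seq (inord x : 'I_n.+1) | x <- l] <= n by rewrite size_map.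
exists (Bseq sz) => //; rewrite /f /= -map_comp -[RHS]map_id.
by apply/eq_in_map => x /(allP le_n) x_lt /=; rewrite inordK.
Qed.

Definition num_unimodal (n : nat) : nat := #|` fset_set (unimodal_seqs n) |.

Definition num_unimodal_between (R : realType) (n : nat) (a b : R) : nat :=
  #|` fset_set [set l | unimodal_seqs n l /\
                        (a < (size l)%:R)%R /\ ((size l)%:R < b)%R] |.

(* Main.v *)
Require Import Defs.
From mathcomp Require Import all_boot all_order all_algebra.
From mathcomp Require Import finmap.
From mathcomp Require Import all_classical all_reals all_analysis.
From mathcomp Require Import ring lra zify.

Import Order.TTheory GRing.Theory Num.Theory.
Import numFieldNormedType.Exports.

Local Open Scope classical_set_scope.
Local Open Scope ring_scope.

(** A strongly unimodal sequence with peak m consists of two sets A and B of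
    positive integers below m, and its size is m + sum A + sum B. Ignoring the
    peak, it behaves like a pair of partitions into distinct parts, for which
    everything is governed by the generating product over j of
    (1 + w q ^ j) ^ 2, with q marking the size and w the number of parts.

    Put q = exp (- t) with t tending to 0. The asymptotics needed are two
    Riemann sums: t * sum_j ln (1 + q ^ j) tends to pi ^ 2 / 12
    (log_distinct_cvg), and t * sum_j q ^ j / (1 + q ^ j) tends to ln 2
    (mean_parts_cvg); the latter is the derivative of the former in ln w
    at w = 1. The value pi ^ 2 / 12 is the alternating sum of the 1 / k ^ 2,
    obtained from the duplication formula of 1 / sin ^ 2.

    With tau = pi / sqrt 6 (crit_rate) the choice t = tau / sqrt n makes the
    expected size about n. Two exponential estimates follow.

    - Sequences with too many or too few parts are rare: weighting a sequence
      by exp (u * #parts - t * size), with u a small number of the appropriate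
      sign, Markov's inequality bounds their number by
      exp (sqrt n * (2 tau - 3 k)) for some k > 0 (card_unimodal_growth).
      The first order term in u vanishes exactly at
      #parts = sqrt n * 2 ln 2 / tau, which is the constant of the theorem.

    - There are at least exp (sqrt n * (2 tau - k)) sequences in total, for
      every k > 0 (num_unimodal_growth). A pair of sets A, B of integers at most
      N can be completed by a peak of size n - sum A - sum B as soon as this
      exceeds N, so it is enough to count pairs with sum A + sum B < n - N.
      Here N is of order n ^ (3/4): large enough for the product up to N to have
      full weight, small enough not to matter in n - N. At a parameter t
      slightly above tau / sqrt n almost all of the weight lies on sums slightly
      below n, by Chernoff bounds on both sides, and weight converts to number.

    The ratio of the two bounds is exp (- 2 k * sqrt n), which tends to 0. *)

(** * Two trigonometric inequalities and the sum of 1 / sin ^ 2 *)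

Lemma ge0_of_derive_ge0 (R : realType) (f df : R -> R) (b : R) :
    (forall x, 0 <= x -> x <= b -> is_derive x 1 f (df x)) ->
    (forall x, 0 <= x -> x <= b -> 0 <= df x) -> f 0 = 0 ->
  forall x, 0 <= x -> x <= b -> 0 <= f x.
Proof.
move=> fE df_ge0 f0 x; rewrite le_eqVlt => /predU1P[<-|x_gt0] xb.
  by rewrite f0.
have [||c] := @MVT _ f df 0 x x_gt0.
- move=> y; rewrite in_itv/= => /andP[y_gt0 yx].
  by apply: fE; [exact: ltW | exact: le_trans (ltW yx) xb].
- apply: derivable_within_continuous => y; rewrite in_itv/= => /andP[y_ge0 yx].
  by apply: ex_derive; apply: fE => //; exact: le_trans yx xb.
rewrite in_itv/= f0 !subr0 => /andP[c_gt0 cx] ->.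
apply: mulr_ge0 (ltW x_gt0).
by apply: df_ge0; [exact: ltW | exact: le_trans (ltW cx) xb].
Qed.

Lemma sin_le_id (R : realType) (x : R) : 0 <= x -> sin x <= x.
Proof.
move=> x_ge0; rewrite -subr_ge0.
apply: (@ge0_of_derive_ge0 R (fun y => y - sin y) (fun y => 1 - cos y) x) => //.
by rewrite sin0 subrr.
Qed.

(** This is the inequality x <= tan x, cleared of its denominator. *)
Lemma id_mul_cos_le_sin (R : realType) (x : R) :
  0 <= x -> x <= pi / 2 -> x * cos x <= sin x.
Proof.
move=> x_ge0 x_le; rewrite -subr_ge0.
apply: (@ge0_of_derive_ge0 R (fun y => sin y - y * cos y)
          (fun y => y * sin y) (pi / 2)) => //.
- move=> y _ _; apply: is_derive_eq.
  by rewrite /GRing.scale/=; ring.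
- move=> y y_ge0 y_le; apply: mulr_ge0 => //; apply: sin_ge0_pi.
  by rewrite y_ge0/=; have := pi_ge0 R; lra.
- by rewrite /= sin0 mul0r subrr.
Qed.

Lemma csc2_half (R : realType) (y : R) : sin y != 0 ->
  (sin (y / 2)) ^- 2 + (cos (y / 2)) ^- 2 = 4 * (sin y) ^- 2.
Proof.
have -> : sin y = (cos (y / 2) * sin (y / 2)) *+ 2.
  by rewrite -sin_mulr2n; congr sin; rewrite mulr2n; lra.
move: (cos2Dsin2 (y / 2)); move: (cos _) (sin _) => c s cs1 sc_neq0.
have c_neq0 : c != 0 by apply: contraNneq sc_neq0 => ->; rewrite mul0r mul0rn.
have s_neq0 : s != 0 by apply: contraNneq sc_neq0 => ->; rewrite mulr0 mul0rn.
have -> : s ^- 2 + c ^- 2 = (c ^+ 2 + s ^+ 2) / (c * s) ^+ 2.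
  by field; rewrite c_neq0 s_neq0.
by rewrite cs1; field; rewrite c_neq0 s_neq0.
Qed.

(** The duplication formula for 1 / sin ^ 2, unfolded n times. *)
Lemma sum_csc2 (R : realType) (n : nat) (x : R) : 0 < x -> x < pi ->
  \sum_(k < (2 ^ n)%N) (sin ((x + k%:R * pi) / 2 ^+ n)) ^- 2
    = 4 ^+ n * (sin x) ^- 2.
Proof.
move=> x_gt0 x_lt; elim: n => [|n IHn].
  by rewrite big_ord1 !expr0 divr1 mul0r addr0 mul1r.
rewrite expnS mul2n -addnn big_split_ord /= -big_split /=.
rewrite [4 ^+ n.+1]exprS -mulrA -IHn mulr_sumr; apply: eq_bigr => k _.
set y := (x + k%:R * pi) / 2 ^+ n.
have pow_gt0 : 0 < 2 ^+ n :> R by rewrite exprn_gt0.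
have yE : (x + k%:R * pi) / 2 ^+ n.+1 = y / 2.
  by rewrite /y exprS; field; rewrite lt0r_neq0.
have -> : sin ((x + (2 ^ n + k)%:R * pi) / 2 ^+ n.+1) = cos (y / 2).
  rewrite -sinDpihalf -yE natrD natrX exprS; congr sin.
  by field; rewrite lt0r_neq0.
rewrite yE.
apply: csc2_half; apply: lt0r_neq0; apply: sin_gt0_pi; apply/andP; split.
  by rewrite divr_gt0// ltr_wpDr// mulr_ge0// pi_ge0.
rewrite ltr_pdivrMr// (@lt_le_trans _ _ (k.+1%:R * pi))//.
  by rewrite -natr1 mulrDl mul1r addrC ltrD2l.
by rewrite mulrC ler_pM2l ?pi_gt0// -natrX ler_nat ltn_ord.
Qed.

(** At x = pi / 2 the angles are symmetric about pi / 2; folding the sum leaves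
    the angles in the first quadrant. *)
Lemma sum_csc2_odd (R : realType) (n : nat) :
  \sum_(k < (2 ^ n)%N) (sin ((k.*2.+1)%:R * (pi / 2 ^+ n.+2))) ^- 2
    = 2 * 4 ^+ n :> R.
Proof.
have pi_gt0 := @pi_gt0 R.
have := @sum_csc2 R n.+1 (pi / 2); rewrite sin_pihalf expr1n invr1 mulr1.
have -> : 0 < pi / 2 :> R by lra.
have -> : pi / 2 < pi :> R by lra.
move=> /(_ isT isT).
pose F (k : nat) : R := (sin ((k.*2.+1)%:R * (pi / 2 ^+ n.+2))) ^- 2.
have pow_gt0 m : 0 < 2 ^+ m :> R by rewrite exprn_gt0.
under eq_bigr => k _.
  have -> : (pi / 2 + k%:R * pi) / 2 ^+ n.+1
    = (k.*2.+1)%:R * (pi / 2 ^+ n.+2) :> R.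
    by rewrite -[k.*2.+1%:R]natr1 -muln2 natrM !exprS; field; rewrite lt0r_neq0.
  rewrite -/(F k); over.
rewrite expnS mul2n -addnn big_split_ord /=.
rewrite [X in _ + X](reindex_inj rev_ord_inj) /=.
under [X in _ + X]eq_bigr => k _.
  have -> : F (2 ^ n + (2 ^ n - k.+1))%N = F k.
    rewrite /F; set a := (k.*2.+1)%:R * _.
    have -> : sin a = sin (- (a - pi)).
      by rewrite sinN -sinDpi subrK.
    congr ((sin _) ^- 2).
    have -> : (2 ^ n + (2 ^ n - k.+1)).*2.+1%:R = 4 * 2 ^+ n - k.*2.+1%:R :> R.
      have le_k := ltn_ord k.
      apply/eqP; rewrite eq_sym subr_eq -natrX -natrM -natrD eqr_nat.
      by apply/eqP; lia.
    by rewrite /a !exprS; field; rewrite lt0r_neq0.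
  over.
rewrite -/F exprS => sumE; rewrite -/F; lra.
Qed.

(** * The alternating sum of the inverse squares *)

(** On the first quadrant 1 / sin ^ 2 - 1 <= 1 / x ^ 2 <= 1 / sin ^ 2. Summed
    over the 2 ^ n angles (2 k + 1) h the two outer sums are known and differ
    by 2 ^ n, while their size is of order 4 ^ n. *)
Lemma sum_odd_inv_sqr_bounds (R : realType) (n : nat) :
  pi ^+ 2 / 8 - pi ^+ 2 / 16 / 2 ^+ n
    <= \sum_(k < (2 ^ n)%N) ((k.*2.+1)%:R : R) ^- 2 <= pi ^+ 2 / 8.
Proof.
have pi_gt0 := @pi_gt0 R.
have pow_gt0 m : 0 < 2 ^+ m :> R by rewrite exprn_gt0.
set h : R := pi / 2 ^+ n.+2.
have h_gt0 : 0 < h by rewrite divr_gt0.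
have hE : (2 ^+ n * h) = pi / 4.
  by rewrite /h !exprS; field; rewrite lt0r_neq0.
have angle (k : 'I_(2 ^ n)) :
    let x : R := (k.*2.+1)%:R * h in
    x ^- 2 <= sin x ^- 2 /\ sin x ^- 2 - 1 <= x ^- 2.
  move=> x.
  have x_gt0 : 0 < x by rewrite mulr_gt0.
  have x_lt : x < pi / 2.
    have le_k : k.*2.+1%:R < 2 * 2 ^+ n :> R.
      by rewrite -natrX -natrM ltr_nat; have := ltn_ord k; lia.
    have -> : pi / 2 = 2 * 2 ^+ n * h by lra.
    by rewrite ltr_pM2r.
  have sin_gt0 : 0 < sin x by apply: sin_gt0_pihalf; rewrite x_gt0.
  have sin_le := sin_le_id R x (ltW x_gt0).
  have cos_le := id_mul_cos_le_sin R x (ltW x_gt0) (ltW x_lt).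
  have cos_gt0 : 0 < cos x by apply: cos_gt0_pihalf; rewrite x_lt andbT; lra.
  split.
    by rewrite lef_pV2 ?posrE ?exprn_gt0// ler_sqr ?nnegrE// ltW.
  have -> : sin x ^- 2 - 1 = cos x ^+ 2 / sin x ^+ 2.
    by rewrite cos2sin2; field; rewrite lt0r_neq0.
  rewrite ler_pdivrMr ?exprn_gt0// mulrC ler_pdivlMr ?exprn_gt0//.
  by rewrite mulrC -exprMn ler_sqr ?nnegrE ?mulr_ge0// ltW.
have term (k : 'I_(2 ^ n)) :
    (k.*2.+1)%:R ^- 2 = h ^+ 2 * ((k.*2.+1)%:R * h) ^- 2 :> R.
  move: (k.*2.+1%:R) (ltr0n R k.*2.+1) => c c_gt0.
  by field; rewrite !lt0r_neq0.
under eq_bigr do rewrite term.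
rewrite -mulr_sumr.
have hi : \sum_(k < (2 ^ n)%N) ((k.*2.+1)%:R * h) ^- 2 <= 2 * 4 ^+ n.
  by rewrite -sum_csc2_odd; apply: ler_sum => k _; have [] := angle k.
have lo : 2 * 4 ^+ n - 2 ^+ n <= \sum_(k < (2 ^ n)%N) ((k.*2.+1)%:R * h) ^- 2.
  rewrite -sum_csc2_odd.
  have -> : 2 ^+ n = \sum_(k < (2 ^ n)%N) (1 : R).
    by rewrite sumr_const card_ord -natrX.
  by rewrite -sumrB; apply: ler_sum => k _; have [] := angle k.
have h2E : h ^+ 2 * 4 ^+ n = pi ^+ 2 / 16.
  have -> : 4 ^+ n = (2 ^+ n) ^+ 2 :> R.
    by rewrite -exprM mulnC exprM; congr (_ ^+ n); lra.
  by rewrite -exprMn mulrC hE; field.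
have h2E' : h ^+ 2 * 2 ^+ n = pi ^+ 2 / 16 / 2 ^+ n.
  rewrite -h2E; have -> : 4 = 2 * 2 :> R by lra.
  by rewrite [(2 * 2) ^+ n]exprMn mulrA mulfK// lt0r_neq0.
have h2_gt0 : 0 < h ^+ 2 by rewrite exprn_gt0.
apply/andP; split.
  apply: le_trans (ler_wpM2l (ltW h2_gt0) lo).
  by rewrite mulrBr h2E' mulrCA h2E; lra.
apply: le_trans (ler_wpM2l (ltW h2_gt0) hi) _.
by rewrite mulrCA h2E; lra.
Qed.

Lemma sum_double (V : zmodType) (f : nat -> V) (N : nat) :
  \sum_(k < N.*2) f k = \sum_(k < N) f k.*2 + \sum_(k < N) f k.*2.+1.
Proof.
elim: N => [|N IHN]; first by rewrite !big_ord0 addr0.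
by rewrite doubleS !big_ord_recr/= IHN addrACA addrA.
Qed.

(** The even terms are a quarter of the sum of half the length, so the odd sums
    determine the whole; the error bound reproduces itself because
    1 / 16 + (1 / 4) / 4 = (1 / 4) / 2. *)
Lemma sum_inv_sqr_bounds (R : realType) (n : nat) :
  pi ^+ 2 / 6 - pi ^+ 2 / 4 / 2 ^+ n
    <= \sum_(k < (2 ^ n)%N) (k.+1%:R : R) ^- 2 <= pi ^+ 2 / 6.
Proof.
elim: n => [|n /andP[IHlo IHhi]].
  rewrite big_ord1; have := sum_odd_inv_sqr_bounds R 0.
  by rewrite big_ord1 !expr0 expr1n; have := sqr_ge0 (@pi R); lra.
have /andP[lo hi] := sum_odd_inv_sqr_bounds R n.
rewrite expnS mul2n (@sum_double _ (fun k => k.+1%:R ^- 2)).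
have -> : \sum_(k < (2 ^ n)%N) k.*2.+2%:R ^- 2
    = 4^-1 * \sum_(k < (2 ^ n)%N) k.+1%:R ^- 2 :> R.
  rewrite mulr_sumr; apply: eq_bigr => k _.
  by rewrite -doubleS -mul2n natrM exprMn invfM -(natrX R 2 2).
have -> : pi ^+ 2 / 4 / 2 ^+ n.+1 = pi ^+ 2 / 8 / 2 ^+ n :> R.
  by rewrite [2 ^+ n.+1]exprS; field; rewrite lt0r_neq0// exprn_gt0.
move: IHlo IHhi lo hi; rewrite -![pi ^+ 2 / _ / _]mulrA.
rewrite ![_^-1 * (2 ^+ n)^-1]mulrC !mulrA.
move: (\sum_(_ < _) _) (\sum_(_ < _) _) (_ / 2 ^+ n) => a c d.
lra.
Qed.

Definition alt_inv_sqr_sum {R : realType} (K : nat) : R :=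
  \sum_(k < K) (-1) ^+ k / k.+1%:R ^+ 2.

(** Odd terms minus even terms: pi ^ 2 / 8 - (pi ^ 2 / 6) / 4. *)
Lemma alt_inv_sqr_sum_cvg (R : realType) :
  alt_inv_sqr_sum (2 ^ n.+1) @[n --> \oo] --> (pi ^+ 2 / 12 : R).
Proof.
have pow_cvg : (2^-1 : R) ^+ n @[n --> \oo] --> (0 : R).
  by apply: cvg_expr; rewrite ger0_norm; lra.
have bounds n : (pi : R) ^+ 2 / 12 - pi ^+ 2 / 16 * 2^-1 ^+ n
    <= @alt_inv_sqr_sum R (2 ^ n.+1) <= pi ^+ 2 / 12 + pi ^+ 2 / 16 * 2^-1 ^+ n.
  have := sum_inv_sqr_bounds R n; have := sum_odd_inv_sqr_bounds R n.
  have -> : alt_inv_sqr_sum (2 ^ n.+1)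
      = \sum_(k < (2 ^ n)%N) k.*2.+1%:R ^- 2
        - 4^-1 * \sum_(k < (2 ^ n)%N) k.+1%:R ^- 2 :> R.
    rewrite /alt_inv_sqr_sum expnS mul2n.
    rewrite (@sum_double _ (fun k => (-1) ^+ k / k.+1%:R ^+ 2)).
    rewrite mulr_sumr -sumrN; congr (_ + _); apply: eq_bigr => k _.
      by rewrite -signr_odd odd_double mul1r.
    rewrite -signr_odd oddS odd_double -doubleS -mul2n natrM exprMn invfM.
    by rewrite -(natrX R 2 2) mulN1r.
  rewrite exprVn; move: (\sum_(_ < _) _) (\sum_(_ < _) _) => a c.
  move: ((2 ^+ n)^-1) (pi ^+ 2) => w p; lra.
have err_cvg : pi ^+ 2 / 16 * 2^-1 ^+ n @[n --> \oo] --> (0 : R).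
  by rewrite -[X in _ --> X](mulr0 (pi ^+ 2 / 16)); exact: cvgMl_tmp.
apply: (@squeeze_cvgr _ _ _ _ (fun n => pi ^+ 2 / 12 - pi ^+ 2 / 16 * 2^-1 ^+ n)
  (fun n => pi ^+ 2 / 12 + pi ^+ 2 / 16 * 2^-1 ^+ n)).
- by apply: nearW => n; exact: bounds.
- by rewrite -[X in _ --> X]subr0; apply: cvgB err_cvg; exact: cvg_cst.
- by rewrite -[X in _ --> X]addr0; apply: cvgD err_cvg; exact: cvg_cst.
Qed.

(** * Riemann sums *)

(** The function g plays the role of - f': the first two hypotheses hold as
    soon as f is convex with derivative - g. They compare each term of the sum
    with an increment of f, so that the bounds telescope and no integral is
    involved. *)
Lemma riemann_sum_cvg (R : realType) (f g : R -> R) (t : nat -> R)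
    (N : nat -> nat) :
    (forall x h : R, 0 <= x -> 0 <= h -> h * g (x + h) <= f x - f (x + h)) ->
    (forall x h : R, 0 <= x -> 0 <= h -> f x - f (x + h) <= h * g x) ->
    {for 0, continuous f} -> f x @[x --> +oo] --> 0 ->
    (forall n, 0 <= t n) -> t n @[n --> \oo] --> 0 ->
    t n * (N n)%:R @[n --> \oo] --> +oo ->
  t n * (\sum_(j < N n) g (t n * j.+1%:R)) @[n --> \oo] --> f 0.
Proof.
move=> lo hi f0 fy t_ge0 t0 tNy.
have stepE s m : s * m.+1%:R = s * m%:R + s :> R.
  by rewrite -natr1 mulrDr mulr1.
have sumS (s : R) m : s * (\sum_(j < m.+1) g (s * j.+1%:R))
    = s * (\sum_(j < m) g (s * j.+1%:R)) + s * g (s * m.+1%:R) :> R.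
  by rewrite big_ord_recr mulrDr.
have sum_le (s : R) m : 0 <= s ->
    s * (\sum_(j < m) g (s * j.+1%:R)) <= f 0 - f (s * m%:R).
  move=> s_ge0; elim: m => [|m IHm]; first by rewrite big_ord0 !mulr0 subrr.
  rewrite sumS.
  have := lo (s * m%:R) s; rewrite -stepE mulr_ge0 // => /(_ isT s_ge0).
  lra.
have sum_ge (s : R) m : 0 <= s ->
    f s - f (s * m.+1%:R) <= s * (\sum_(j < m) g (s * j.+1%:R)).
  move=> s_ge0; elim: m => [|m IHm].
    by rewrite big_ord0 mulr0 mulr1 subrr.
  rewrite sumS.
  have := hi (s * m.+1%:R) s; rewrite -stepE mulr_ge0 // => /(_ isT s_ge0).
  lra.
apply: (@squeeze_cvgr _ _ _ _ (fun n => f (t n) - f (t n * (N n).+1%:R))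
  (fun n => f 0 - f (t n * (N n)%:R))).
- by apply: nearW => n; rewrite sum_ge//= sum_le.
- rewrite -[X in _ --> X]subr0; apply: cvgB; first exact: (cvg_comp _ _ t0 f0).
  apply: (cvg_comp (fun n => t n * (N n).+1%:R) f _ fy).
  apply/cvgryPge => A; have /cvgryPge/(_ A) := tNy; apply: filterS => n tN_ge.
  by rewrite stepE; have := t_ge0 n; lra.
- rewrite -[X in _ --> X]subr0; apply: cvgB; first exact: cvg_cst.
  exact: (cvg_comp _ _ tNy fy).
Qed.

(** Jensen's inequality for exp and a Bernoulli variable of parameter p. It
    expresses the convexity of ln (1 + exp (- x)), with p = exp (- x) /
    (1 + exp (- x)) the opposite of the derivative. *)
Lemma le_ln_bernoulli (R : realType) (p s : R) : 0 <= p -> p <= 1 ->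
  p * s <= ln (1 + p * (expR s - 1)).
Proof.
move=> p_ge0 p_le1; have es_gt0 := expR_gt0 s.
have arg_gt0 : 0 < 1 + p * (expR s - 1).
  have -> : 1 + p * (expR s - 1) = (1 - p) + p * expR s by ring.
  have [->|p_neq1] := eqVneq p 1; first by rewrite subrr add0r mul1r.
  have p_lt1 : p < 1 by rewrite lt_neqAle p_neq1.
  by have := mulr_ge0 p_ge0 (ltW es_gt0); lra.
rewrite -ler_expR lnK ?posrE//.
have u1 := expR_ge1Dx ((1 - p) * s).
have u2 := expR_ge1Dx (- (p * s)).
have e1 : expR s = expR (p * s) * expR ((1 - p) * s).
  by rewrite -expRD; congr expR; ring.
have e2 : 1 = expR (p * s) * expR (- (p * s)) by rewrite expRxMexpNx_1.
have eps_gt0 := expR_gt0 (p * s).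
rewrite e1; move: u1 u2 e2 eps_gt0.
move: (expR (p * s)) (expR ((1 - p) * s)) (expR (- (p * s))) => a b c.
move=> u1 u2 e2 a_gt0.
have -> : 1 + p * (a * b - 1) = a * ((1 - p) * c + p * b).
  have -> : a * ((1 - p) * c + p * b) = (1 - p) * (a * c) + p * (a * b) by ring.
  by rewrite -e2; ring.
rewrite -[leLHS]mulr1 ler_pM2l//.
have := ler_wpM2l p_ge0 u1.
have q_ge0 : 0 <= 1 - p by lra.
by have := ler_wpM2l q_ge0 u2; lra.
Qed.

Lemma expR_riemann_cvg (R : realType) (k : nat) (t : nat -> R)
    (N : nat -> nat) :
    (forall n, 0 <= t n) -> t n @[n --> \oo] --> 0 ->
    t n * (N n)%:R @[n --> \oo] --> +oo ->
  t n * (\sum_(j < N n) expR (- (t n * j.+1%:R)) ^+ k.+1) @[n --> \oo]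
    --> (k.+1%:R^-1 : R).
Proof.
move=> t_ge0 t0 tNy.
pose a : R := k.+1%:R.
have a_gt0 : 0 < a by rewrite ltr0n.
pose f (x : R) := a^-1 * expR (- (a * x)).
have -> : k.+1%:R^-1 = f 0 by rewrite /f mulr0 oppr0 expR0 mulr1.
under eq_fun do under eq_bigr do rewrite -expRM_natl mulrN -/a.
have fB x h :
    f x - f (x + h) = a^-1 * (expR (- (a * x)) * (1 - expR (- (a * h)))).
  by rewrite /f mulrDr opprD expRD; ring.
have fB' x h :
    f x - f (x + h) = a^-1 * (expR (- (a * (x + h))) * (expR (a * h) - 1)).
  rewrite /f [in RHS]mulrBr -expRD mulr1 -mulrBr.
  by congr (_ * (expR _ - _)); ring.
apply: (@riemann_sum_cvg R f (fun x => expR (- (a * x)))) => //.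
- move=> x h x_ge0 h_ge0.
  rewrite fB' [leLHS]mulrC [leRHS]mulrCA ler_pM2l ?expR_gt0//.
  by rewrite ler_pdivlMl//; have := expR_ge1Dx (a * h); lra.
- move=> x h x_ge0 h_ge0.
  rewrite fB [leLHS]mulrCA [leRHS]mulrC ler_pM2l ?expR_gt0//.
  by rewrite ler_pdivrMl//; have := expR_ge1Dx (- (a * h)); lra.
- apply: cvgM; first exact: cvg_cst.
  apply: (@continuous_comp _ _ _ (fun x : R => - (a * x)) expR).
    by apply: cvgN; apply: cvgM; [exact: cvg_cst | exact: cvg_id].
  exact: continuous_expR.
- rewrite -(mulr0 a^-1); apply: cvgM; first exact: cvg_cst.
  apply: (cvg_comp (fun x => a * x) (fun y => expR (- y)) _ (@cvgr_expR R)).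
  by apply: gt0_cvgMry => //; exact: cvg_id.
Qed.

(** The mean number of parts of a random partition into distinct parts at most
    N, when each partition has weight exp (- t * size): the part j is then
    present with probability exp (- t j) / (1 + exp (- t j)). *)
Definition mean_parts {R : realType} (t : R) (N : nat) : R :=
  \sum_(j < N) expR (- (t * j.+1%:R)) / (1 + expR (- (t * j.+1%:R))).

Lemma mean_parts_cvg (R : realType) (t : nat -> R) (N : nat -> nat) :
    (forall n, 0 <= t n) -> t n @[n --> \oo] --> 0 ->
    t n * (N n)%:R @[n --> \oo] --> +oo ->
  t n * mean_parts (t n) (N n) @[n --> \oo] --> ln 2.
Proof.
move=> t_ge0 t0 tNy.
pose f (x : R) := ln (1 + expR (- x)).
have -> : ln 2 = f 0 by rewrite /f oppr0 expR0.
have pos (x : R) : 0 < 1 + expR (- x) by rewrite addr_gt0 ?expR_gt0.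
have p_ge0 (x : R) : 0 <= expR (- x) / (1 + expR (- x)).
  by rewrite divr_ge0 ?expR_ge0// ltW.
have p_le1 (x : R) : expR (- x) / (1 + expR (- x)) <= 1.
  by rewrite ler_pdivrMr// mul1r; lra.
have fB x h : f (x + h) - f x
    = ln (1 + expR (- x) / (1 + expR (- x)) * (expR (- h) - 1)).
  rewrite /f -ln_div ?posrE//; congr ln; rewrite opprD expRD.
  by field; rewrite lt0r_neq0.
apply: (@riemann_sum_cvg R f (fun x => expR (- x) / (1 + expR (- x)))) => //.
- move=> x h x_ge0 h_ge0.
  have := le_ln_bernoulli R _ h (p_ge0 (x + h)) (p_le1 (x + h)).
  have := fB (x + h) (- h); rewrite addrK opprK => <-.
  by rewrite mulrC.
- move=> x h x_ge0 h_ge0.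
  have := le_ln_bernoulli R _ (- h) (p_ge0 x) (p_le1 x).
  by rewrite -fB mulrN [h * _]mulrC; lra.
- apply: (cvg_comp (fun x : R => 1 + expR (- x)) (@ln R)
    (G := nbhs (1 + expR (- 0)))).
    apply: cvgD; first exact: cvg_cst.
    apply: (@continuous_comp _ _ _ (fun x : R => - x) expR).
      by apply: cvgN; exact: cvg_id.
    exact: continuous_expR.
  exact: continuous_ln.
- rewrite -ln1 -[in X in _ --> X](addr0 1).
  apply: (cvg_comp (fun x : R => 1 + expR (- x)) (@ln R)
    (G := nbhs (1 + 0 : R))).
    by apply: cvgD; [exact: cvg_cst | exact: (@cvgr_expR R)].
  by apply: continuous_ln; rewrite addr0.
Qed.

(** * The logarithm of the generating product *)

Lemma is_derive_alt_log_sum (R : realType) (m : nat) (x : R) :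
  is_derive x 1 (fun x : R => \sum_(k < m) (-1) ^+ k / k.+1%:R * x ^+ k.+1)
    (\sum_(k < m) (- x) ^+ k).
Proof.
elim: m => [|m IHm].
  rewrite big_ord0 (_ : (fun _ => _) = cst 0); first exact: is_derive_cst.
  by apply/funext => z; rewrite big_ord0.
rewrite big_ord_recr (_ : (fun _ => _)
  = (fun x : R => \sum_(k < m) (-1) ^+ k / k.+1%:R * x ^+ k.+1)
    + ((-1) ^+ m / m.+1%:R) \*: (id ^+ m.+1 : R -> R)); last first.
  apply/funext => z; rewrite big_ord_recr; congr (_ + _ * _).
  by rewrite exprfctE.
apply: is_deriveD; apply: is_derive_eq.
rewrite /GRing.scale/= mulr1 mulrA divfK ?pnatr_eq0//.
by rewrite [RHS]exprNn.
Qed.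

Lemma is_derive_ln1D_sub_alt (R : realType) (m : nat) (x : R) : 0 <= x ->
  is_derive x 1
    (fun x : R => ln (1 + x) - \sum_(k < m) (-1) ^+ k / k.+1%:R * x ^+ k.+1)
    ((- x) ^+ m / (1 + x)).
Proof.
move=> x_ge0.
have x1_gt0 : 0 < 1 + x by lra.
have ln_der : is_derive x 1 (fun x : R => ln (1 + x)) (1 + x)^-1.
  rewrite -[X in is_derive _ _ _ X]mulr1.
  apply: (@is_derive1_comp R (@ln R) (fun x => 1 + x)).
    exact: is_derive1_ln.
  by apply: is_derive_eq; rewrite add0r mulr1.
apply: (is_derive_eq (is_deriveB ln_der (is_derive_alt_log_sum R m x))).
apply: (mulIf (lt0r_neq0 x1_gt0)); rewrite divfK ?lt0r_neq0//.
rewrite mulrBl mulVf ?lt0r_neq0//.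
by have := subrX1 (- x) m; lra.
Qed.

Lemma ln1D_ge_alt (R : realType) (K : nat) (y : R) : 0 <= y ->
  \sum_(k < K.*2) (-1) ^+ k / k.+1%:R * y ^+ k.+1 <= ln (1 + y).
Proof.
move=> y_ge0; rewrite -subr_ge0.
pose f (x : R) := ln (1 + x) - \sum_(k < K.*2) (-1) ^+ k / k.+1%:R * x ^+ k.+1.
apply: (@ge0_of_derive_ge0 R f (fun x : R => (- x) ^+ K.*2 / (1 + x)) y) => //.
- by move=> x x_ge0 _; exact: is_derive_ln1D_sub_alt.
- move=> x x_ge0 _; rewrite divr_ge0 ?addr_ge0// -mul2n exprM sqrrN.
  by rewrite exprn_ge0 ?sqr_ge0.
- rewrite /f addr0 ln1 big1 ?subrr// => k _.
  by rewrite expr0n mulr0.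
Qed.

Lemma ln1D_le_alt (R : realType) (K : nat) (y : R) : 0 <= y ->
  ln (1 + y) <= \sum_(k < K.*2) (-1) ^+ k / k.+1%:R * y ^+ k.+1
                + y ^+ K.*2.+1 / K.*2.+1%:R.
Proof.
move=> y_ge0.
pose f (x : R) :=
  ln (1 + x) - \sum_(k < K.*2.+1) (-1) ^+ k / k.+1%:R * x ^+ k.+1.
suff : 0 <= - f y.
  rewrite oppr_ge0 /f big_ord_recr subr_le0 => /le_trans; apply.
  by rewrite -signr_odd odd_double mul1r [_^-1 * _]mulrC.
apply: (@ge0_of_derive_ge0 R (fun x => - f x)
          (fun x : R => - ((- x) ^+ K.*2.+1 / (1 + x))) y) => //.
- move=> x x_ge0 _.
  exact: (is_deriveN (is_derive_ln1D_sub_alt R _ _ x_ge0)).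
- move=> x x_ge0 _; rewrite -mulNr divr_ge0 ?addr_ge0//.
  rewrite exprS -mul2n exprM sqrrN.
  by rewrite mulNr opprK mulr_ge0// exprn_ge0 ?sqr_ge0.
- rewrite /f addr0 ln1 big1 ?subrr ?oppr0// => k _.
  by rewrite expr0n mulr0.
Qed.

Lemma cvg_sum_ord (R : realType) (K : nat) (u : nat -> nat -> R)
    (l : nat -> R) :
    (forall k, u k n @[n --> \oo] --> l k) ->
  \sum_(k < K) u k n @[n --> \oo] --> \sum_(k < K) l k.
Proof.
move=> ul; elim: K => [|K IHK].
  rewrite big_ord0 [X in X @ _ --> _](_ : _ = cst 0); first exact: cvg_cst.
  by apply/funext => n; rewrite big_ord0.
rewrite big_ord_recr [X in X @ _ --> _](_ : _
  = (fun n => \sum_(k < K) u k n) + u K); first exact: cvgD.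
by apply/funext => n; rewrite big_ord_recr.
Qed.

(** The logarithm of the generating product of partitions into distinct parts,
    all at most N, at the point exp (- t). *)
Definition log_distinct {R : realType} (t : R) (N : nat) : R :=
  \sum_(j < N) ln (1 + expR (- (t * j.+1%:R))).

(** Expand each logarithm; the powers contribute Riemann sums tending to
    1 / k, hence the sum over k to the alternating sum of the 1 / k ^ 2. *)
Lemma log_distinct_cvg (R : realType) (t : nat -> R) (N : nat -> nat) :
    (forall n, 0 <= t n) -> t n @[n --> \oo] --> 0 ->
    t n * (N n)%:R @[n --> \oo] --> +oo ->
  t n * log_distinct (t n) (N n) @[n --> \oo] --> (pi ^+ 2 / 12 : R).
Proof.
move=> t_ge0 t0 tNy.
pose q n (j : nat) : R := expR (- (t n * j.+1%:R)).
have q_ge0 n j : 0 <= q n j by exact: expR_ge0.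
pose P K n : R :=
  t n * \sum_(j < N n) \sum_(k < K) (-1) ^+ k / k.+1%:R * q n j ^+ k.+1.
have PE K n : P K n = \sum_(k < K) (-1) ^+ k / k.+1%:R
                       * (t n * \sum_(j < N n) q n j ^+ k.+1).
  rewrite /P exchange_big/= mulr_sumr; apply: eq_bigr => k _.
  by rewrite -mulr_sumr mulrCA.
have P_cvg K : P K n @[n --> \oo] --> (alt_inv_sqr_sum K : R).
  under eq_cvg do rewrite PE.
  apply: (@cvg_sum_ord R K (fun k n => (-1) ^+ k / k.+1%:R
            * (t n * \sum_(j < N n) q n j ^+ k.+1))
    (fun k => (-1) ^+ k / k.+1%:R ^+ 2)) => k.
  have -> : (-1) ^+ k / k.+1%:R ^+ 2 = (-1) ^+ k / k.+1%:R * k.+1%:R^-1 :> R.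
    by rewrite expr2 invfM mulrA.
  apply: cvgM; first exact: cvg_cst.
  exact: expR_riemann_cvg.
have lo K n : P K.*2 n <= t n * log_distinct (t n) (N n).
  apply: ler_wpM2l => //; apply: ler_sum => j _.
  exact: ln1D_ge_alt.
have hi K n : t n * log_distinct (t n) (N n)
    <= P K.*2 n + (t n * (\sum_(j < N n) q n j ^+ K.*2.+1)) / K.*2.+1%:R.
  rewrite -mulrA -mulrDr mulr_suml -big_split/=.
  apply: ler_wpM2l => //; apply: ler_sum => j _.
  exact: ln1D_le_alt.
apply/cvgrPdist_lt => /= e e_gt0.
have := @alt_inv_sqr_sum_cvg R.
move/cvgrPdist_lt => /(_ (e / 2)); rewrite divr_gt0// => /(_ isT) A_near.
have inv_near : \forall n \near \oo, (2 ^ n.+1).+1%:R ^- 2 < e / 8 :> R.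
  have := @nbhs_infty_ger R (8 / e); apply: filterS => n n_ge.
  have : n%:R < (2 ^ n.+1).+1%:R :> R.
    by rewrite ltr_nat ltnS (leq_trans (leqnSn _)) // ltnW // ltn_expl.
  have : 1 <= (2 ^ n.+1).+1%:R :> R by rewrite ler1n.
  move: ((2 ^ n.+1).+1%:R) => x x_ge1 x_gt.
  have x_gt0 : 0 < x by lra.
  rewrite -[e / 8]invf_div ltf_pV2 ?posrE ?exprn_gt0 ?divr_gt0//.
  by apply: (le_lt_trans n_ge); apply: (lt_le_trans x_gt); nra.
near \oo => i.
pose K := (2 ^ i)%N.
have K2 : (2 ^ i.+1 = K.*2)%N by rewrite expnS mul2n.
have Ai : `|pi ^+ 2 / 12 - alt_inv_sqr_sum K.*2| < e / 2.
  by rewrite -K2; near: i.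
have invi : K.*2.+1%:R ^- 2 < e / 8 :> R by rewrite -K2; near: i.
have tail_cvg : (t n * (\sum_(j < N n) q n j ^+ K.*2.+1)) / K.*2.+1%:R
    @[n --> \oo] --> (K.*2.+1%:R ^- 2 : R).
  rewrite expr2 invfM; apply: cvgM; last exact: cvg_cst.
  exact: expR_riemann_cvg.
have /cvgrPdist_lt/(_ (e / 8)) := P_cvg K.*2; rewrite divr_gt0// => /(_ isT) Pn.
have /cvgrPdist_lt/(_ (e / 8)) := tail_cvg; rewrite divr_gt0// => /(_ isT) Tn.
near=> n.
have : `|alt_inv_sqr_sum K.*2 - P K.*2 n| < e / 8 by near: n.
have : `|K.*2.+1%:R ^- 2
         - (t n * (\sum_(j < N n) q n j ^+ K.*2.+1)) / K.*2.+1%:R| < e / 8.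
  by near: n.
have := lo K n; have := hi K n; move: Ai invi.
rewrite !ltr_norml; move: (alt_inv_sqr_sum _) (P _ _) (_ ^- 2) => A p k.
move: (t n * log_distinct _ _) (t n * (\sum_(_ < _) _) / _) => s v.
lra.
Unshelve. all: by end_near. Qed.

(** * Unimodal sequences as a peak and two sets *)

(** The ordinal i stands for the part i + 1. Sets of ordinals are enumerated in
    increasing order, so they encode strictly increasing sequences. *)
Definition parts {N : nat} (A : {set 'I_N}) : seq nat :=
  [seq (nat_of_ord i).+1 | i <- enum A].

Definition unimodal_of {N : nat} (m : nat) (A B : {set 'I_N}) : seq nat :=
  parts A ++ m :: rev (parts B).

Definition sum_parts {N : nat} (A : {set 'I_N}) : nat :=
  (\sum_(i in A) (nat_of_ord i).+1)%N.

Lemma size_parts N (A : {set 'I_N}) : size (parts A) = #|A|.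
Proof. by rewrite size_map -cardE. Qed.

Lemma sumn_parts N (A : {set 'I_N}) : sumn (parts A) = sum_parts A.
Proof. by rewrite sumnE big_map big_enum. Qed.

Lemma mem_parts N (A : {set 'I_N}) (i : 'I_N) : (i.+1 \in parts A) = (i \in A).
Proof.
apply/mapP/idP => [[j + [/val_inj ->]]|iA]; first by rewrite mem_enum.
by exists i; rewrite ?mem_enum.
Qed.

Lemma parts_bounds N (A : {set 'I_N}) : all (fun x => 0 < x <= N)%N (parts A).
Proof. by apply/allP => _ /mapP[i _ ->] /=. Qed.

Lemma parts_inj N : injective (@parts N).
Proof. by move=> A B eqAB; apply/setP => i; rewrite -!mem_parts eqAB. Qed.

Lemma sorted_parts N (A : {set 'I_N}) : sorted ltn (parts A).
Proof.
apply: (@subseq_sorted _ _ ltn_trans _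
          [seq (nat_of_ord i).+1 | i <- enum 'I_N]).
  by apply: map_subseq; rewrite enumT; exact: filter_subseq.
by rewrite (map_comp succn val) val_enum_ord -(iotaDl 1) iota_ltn_sorted.
Qed.

Lemma parts_onto N (s : seq nat) : sorted ltn s ->
  all (fun x => 0 < x <= N)%N s -> exists A : {set 'I_N}, parts A = s.
Proof.
move=> s_sorted /allP s_bounds.
exists [set i : 'I_N | i.+1 \in s]%SET.
apply: (irr_sorted_eq ltn_trans ltnn) => //; first exact: sorted_parts.
move=> x; apply/mapP/idP => [[i + ->]|xs]; first by rewrite mem_enum inE.
have /andP[x_gt0 x_le] := s_bounds x xs.
have x_lt : (x.-1 < N)%N by rewrite prednK.
by exists (Ordinal x_lt); rewrite ?mem_enum ?inE/= prednK.
Qed.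

Lemma size_unimodal_of N m (A B : {set 'I_N}) :
  size (unimodal_of m A B) = (#|A| + #|B|).+1.
Proof. by rewrite size_cat/= size_rev !size_parts addnS. Qed.

Lemma sumn_unimodal_of N m (A B : {set 'I_N}) :
  sumn (unimodal_of m A B) = (m + (sum_parts A + sum_parts B))%N.
Proof. by rewrite sumn_cat/= sumn_rev !sumn_parts addnCA. Qed.

Lemma strongly_unimodal_of N m (A B : {set 'I_N}) : (N < m)%N ->
  strongly_unimodal (unimodal_of m A B).
Proof.
move=> N_lt.
have gt0 (C : {set 'I_N}) : all (ltn 0) (parts C).
  by apply: sub_all (parts_bounds N C) => x /andP[].
have le_m (C : {set 'I_N}) : all (gtn m) (parts C).
  apply: sub_all (parts_bounds N C) => x /andP[_ x_le].
  exact: leq_ltn_trans x_le N_lt.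
have desc (C : {set 'I_N}) : sorted gtn (m :: rev (parts C)).
  rewrite /= path_sortedE; last by move=> x y z /=; lia.
  by rewrite rev_sorted all_rev le_m sorted_parts.
split.
  rewrite all_cat/= all_rev !gt0 /= andbT.
  exact: leq_ltn_trans N_lt.
exists (size (parts A)); first by rewrite size_cat/= addnS ltnS leq_addr.
split.
  rewrite /unimodal_of -cat_rcons take_size_cat ?size_rcons//.
  rewrite -[rcons _ _]revK rev_rcons rev_sorted.
  exact: desc.
by rewrite /unimodal_of drop_size_cat.
Qed.

(** The two sets can be read off because the peak is the only entry above N. *)
Lemma unimodal_of_inj N m m' (A B A' B' : {set 'I_N}) :
    (N < m)%N -> (N < m')%N ->
  unimodal_of m A B = unimodal_of m' A' B' -> (A, B) = (A', B').
Proof.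
have findE k (C D : {set 'I_N}) : (N < k)%N ->
    find (ltn N) (unimodal_of k C D) = size (parts C).
  move=> N_lt; rewrite find_cat /= N_lt addn0.
  have /negbTE -> // : ~~ has (ltn N) (parts C).
  rewrite -all_predC; apply: sub_all (parts_bounds N C) => x /andP[_ x_le] /=.
  by rewrite -leqNgt.
have takeE k (C D : {set 'I_N}) : (N < k)%N ->
    take (find (ltn N) (unimodal_of k C D)) (unimodal_of k C D) = parts C.
  by move=> N_lt; rewrite findE// take_size_cat.
have dropE k (C D : {set 'I_N}) : (N < k)%N ->
    drop (find (ltn N) (unimodal_of k C D)).+1 (unimodal_of k C D)
    = rev (parts D).
  move=> N_lt; rewrite findE// /unimodal_of -cat_rcons.
  by rewrite drop_size_cat// size_rcons.
move=> N_lt N_lt' eq_of; congr (_, _); apply: parts_inj.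
  by rewrite -(takeE m A B)// eq_of takeE.
by apply: (can_inj revK); rewrite -(dropE m A B)// eq_of dropE.
Qed.

(** Peaks and parts are at most n, so that a single finite type encodes all the
    sequences of size n. *)
Lemma unimodal_of_onto n l : unimodal_seqs n l ->
  exists (m : 'I_n.+1) (A B : {set 'I_n}), unimodal_of m A B = l.
Proof.
move=> [[l_gt0 [k k_lt [sorted_l sorted_r]]] sum_l].
have le_n x : x \in l -> (x <= n)%N.
  rewrite -sum_l; elim: (l) => //= y s IHs; rewrite inE => /predU1P[->|/IHs].
    exact: leq_addr.
  by move=> /leq_trans; apply; exact: leq_addl.
have bounds s : {subset s <= l} -> all (fun x => 0 < x <= n)%N s.
  move=> sl; apply/allP => x /sl xl; rewrite le_n// andbT.
  exact: (allP l_gt0).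
have [A partsA] : exists A : {set 'I_n}, parts A = take k l.
  apply: parts_onto; last by apply: bounds => x /mem_take.
  apply: (subseq_sorted ltn_trans _ sorted_l).
  by rewrite (take_nth 0)// subseq_rcons.
have [B partsB] : exists B : {set 'I_n}, parts B = rev (drop k.+1 l).
  apply: parts_onto; last by apply: bounds => x; rewrite mem_rev => /mem_drop.
  rewrite rev_sorted; move: sorted_r; rewrite (drop_nth 0)//=.
  exact: path_sorted.
have m_lt : (nth 0 l k < n.+1)%N by rewrite ltnS le_n// mem_nth.
exists (Ordinal m_lt), A, B.
by rewrite /unimodal_of partsA partsB revK -drop_nth// cat_take_drop.
Qed.

Definition card_unimodal (n : nat) (P : pred nat) : nat :=
  count (fun l => P (size l)) (fset_set (unimodal_seqs n)).

Lemma mem_fset_unimodal n l :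
  reflect (unimodal_seqs n l) (l \in (fset_set (unimodal_seqs n) : seq _)).
Proof.
have -> : (l \in (fset_set (unimodal_seqs n) : seq _))
    = (l \in unimodal_seqs n).
  exact: (in_fset_set (finite_unimodal_seqs n)).
by apply: (iffP idP); rewrite inE.
Qed.

Lemma num_unimodalE n : num_unimodal n = card_unimodal n predT.
Proof. by rewrite /card_unimodal count_predT. Qed.

Lemma num_unimodal_betweenE (R : realType) n (a b : R) :
  num_unimodal_between n a b = card_unimodal n (fun s => a < s%:R < b).
Proof.
rewrite /card_unimodal -size_filter; apply: perm_size; apply: uniq_perm.
- exact: fset_uniq.
- by rewrite filter_uniq// fset_uniq.
move=> l; rewrite mem_filter.
have fin : finite_set
    [set l | unimodal_seqs n l /\ a < (size l)%:R /\ (size l)%:R < b].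
  by apply: sub_finite_set (finite_unimodal_seqs n) => x [].
have -> : (l \in (fset_set [set l | unimodal_seqs n l /\
    a < (size l)%:R /\ (size l)%:R < b] : seq _))
    = (l \in [set l | unimodal_seqs n l /\ a < (size l)%:R /\ (size l)%:R < b]).
  exact: (in_fset_set fin).
apply/idP/andP => [|[/andP[? ?] /mem_fset_unimodal ?]]; last by rewrite in_setE.
by rewrite in_setE => -[? [-> ->]]; split => //; apply/mem_fset_unimodal.
Qed.

Lemma card_unimodal_predC n (P : pred nat) :
  num_unimodal n = (card_unimodal n P + card_unimodal n (predC P))%N.
Proof.
rewrite num_unimodalE /card_unimodal count_predT.
by rewrite -(count_predC (fun l : seq nat => P (size l))).
Qed.

Lemma card_unimodal_le n (P : pred nat) :
  (card_unimodal n P <=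
   #|[set x : 'I_n.+1 * ({set 'I_n} * {set 'I_n}) |
      (x.1 + (sum_parts x.2.1 + sum_parts x.2.2) == n)
      && P (#|x.2.1| + #|x.2.2|).+1]%SET|)%N.
Proof.
rewrite /card_unimodal -size_filter cardE.
rewrite -(size_map (fun x : 'I_n.+1 * ({set 'I_n} * {set 'I_n}) =>
                      unimodal_of x.1 x.2.1 x.2.2)).
apply: uniq_leq_size; first by rewrite filter_uniq// fset_uniq.
move=> l; rewrite mem_filter => /andP[Pl /mem_fset_unimodal l_uni].
have [m [A [B lE]]] := unimodal_of_onto n l l_uni.
apply/mapP; exists (m, (A, B)) => //; rewrite mem_enum inE/=.
rewrite -sumn_unimodal_of -(size_unimodal_of _ m) lE Pl andbT.
by case: l_uni => _ ->.
Qed.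

(** The peak absorbs whatever size the two sides leave over. *)
Lemma num_unimodal_ge n N :
  (#|[set x : {set 'I_N} * {set 'I_N} |
      N + (sum_parts x.1 + sum_parts x.2) < n]%SET| <= num_unimodal n)%N.
Proof.
rewrite cardE -(size_map (fun x : {set 'I_N} * {set 'I_N} =>
  unimodal_of (n - (sum_parts x.1 + sum_parts x.2)) x.1 x.2)).
apply: uniq_leq_size.
  rewrite map_inj_in_uniq ?enum_uniq// => -[A B] [A' B'].
  rewrite !mem_enum !inE/= => lt1 lt2; apply: unimodal_of_inj.
    by rewrite ltn_subRL addnC.
  by rewrite ltn_subRL addnC.
move=> _ /mapP[[A B] + ->]; rewrite mem_enum inE/= => lt_n.
apply/mem_fset_unimodal; split.
  by apply: strongly_unimodal_of; rewrite ltn_subRL addnC.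
by rewrite sumn_unimodal_of subnK//; lia.
Qed.

(** * Exponential bounds at finite size *)

(** The logarithm of the generating product with an extra weight exp u for each
    part. *)
Definition log_tilted {R : realType} (t u : R) (N : nat) : R :=
  \sum_(j < N) ln (1 + expR (u - t * j.+1%:R)).

Lemma log_tilted0 (R : realType) (t : R) N :
  log_tilted t 0 N = log_distinct t N.
Proof. by apply: eq_bigr => j _; rewrite sub0r. Qed.

Lemma sum_expR_parts (R : realType) (t u : R) (N : nat) :
  \sum_(A : {set 'I_N}) expR (u * #|A|%:R - t * (sum_parts A)%:R)
    = expR (log_tilted t u N).
Proof.
have pos x : 0 < 1 + expR x :> R by rewrite addr_gt0 ?expR_gt0.
rewrite /log_tilted expR_sum.
under [RHS]eq_bigr do rewrite lnK ?posrE// addrC.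
rewrite bigA_distr; apply: eq_bigr => A _.
rewrite -big_mkcond/= -expR_sum; congr expR.
rewrite sumrB sumr_const mulr_natr; congr (_ - _).
by rewrite /sum_parts natr_sum mulr_sumr.
Qed.

Lemma sum_expR_parts2 (R : realType) (t u : R) (N : nat) :
  \sum_(x : {set 'I_N} * {set 'I_N})
     expR (u * (#|x.1| + #|x.2|)%:R - t * (sum_parts x.1 + sum_parts x.2)%:R)
    = expR (2 * log_tilted t u N).
Proof.
have -> : 2 * log_tilted t u N = log_tilted t u N + log_tilted t u N by ring.
rewrite expRD -{1}sum_expR_parts -sum_expR_parts big_distrlr pair_big /=.
apply: eq_bigr => -[A B] _ /=; rewrite -expRD !natrD; congr expR; ring.
Qed.

(** With w = exp u, factor 1 + w q = (1 + q) (1 + (w - 1) q / (1 + q)) and use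
    ln (1 + x) <= x. Positive and negative u serve the two tails. *)
Lemma log_tilted_le (R : realType) (t u : R) (N : nat) :
  log_tilted t u N <= log_distinct t N + (expR u - 1) * mean_parts t N.
Proof.
rewrite mulr_sumr -big_split/=; apply: ler_sum => j _.
rewrite expRD; move: (expR_gt0 u) (expR_gt0 (- (t * j.+1%:R))).
move: (expR u) (expR (- _)) => w q w_gt0 q_gt0.
have q1_gt0 : 0 < 1 + q by lra.
have -> : 1 + w * q = (1 + q) * (1 + (w - 1) * (q / (1 + q))).
  by field; rewrite lt0r_neq0.
have r_gt0 : 0 < 1 + (w - 1) * (q / (1 + q)).
  have -> : 1 + (w - 1) * (q / (1 + q)) = (1 + w * q) / (1 + q).
    by field; rewrite lt0r_neq0.
  by rewrite divr_gt0// addr_gt0// mulr_gt0.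
rewrite lnM ?posrE// lerD2l; apply: le_ln1Dx; lra.
Qed.

(** Markov's inequality for the weight exp (u * #parts - t * size). *)
Lemma card_unimodal_chernoff (R : realType) (n : nat) (P : pred nat)
    (t u y : R) :
    0 <= t -> (forall s : nat, P s -> 0 <= u * (s%:R - y)) ->
  (card_unimodal n P)%:R
    <= n.+1%:R * expR (t * n%:R + u * (1 - y) + 2 * log_tilted t u n).
Proof.
move=> t_ge0 uP.
have := card_unimodal_le n P; rewrite -(ler_nat R) => /le_trans; apply.
pose w (x : {set 'I_n} * {set 'I_n}) : R :=
  expR (u * (#|x.1| + #|x.2|)%:R - t * (sum_parts x.1 + sum_parts x.2)%:R).
have -> : n.+1%:R * expR (t * n%:R + u * (1 - y) + 2 * log_tilted t u n)
    = \sum_(x : 'I_n.+1 * ({set 'I_n} * {set 'I_n}))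
        expR (t * n%:R + u * (1 - y)) * w x.2.
  rewrite -(pair_bigA _ (fun _ z => expR (t * n%:R + u * (1 - y)) * w z)) /=.
  rewrite sumr_const card_ord -mulr_sumr /w sum_expR_parts2 -expRD.
  by rewrite -[RHS]mulr_natl.
rewrite -sum1_card natr_sum.
set S := finset _; rewrite [leRHS](bigID (mem S)) /=.
apply: ler_wpDr; first by apply: sumr_ge0 => x _; rewrite mulr_ge0 ?expR_ge0.
apply: ler_sum => -[m [A B]]; rewrite inE /= => /andP[/eqP nE /uP u_ge0].
have -> : n%:R = m%:R + (sum_parts A + sum_parts B)%:R :> R.
  by rewrite -natrD nE.
rewrite /w/= -expRD -[1%:R]expR0 ler_expR.
have := mulr_ge0 t_ge0 (ler0n R m).
move: u_ge0; rewrite -natr1.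
by move: (sum_parts A + sum_parts B)%N (#|A| + #|B|)%N => T s; lra.
Qed.

(** Of the total weight at t, a Chernoff bound at t1 < t removes the pairs too
    large to leave room for a peak above N, and one at t2 > t removes those of
    size below a, whose weight says little about their number. *)
Lemma num_unimodal_chernoff (R : realType) (n N : nat) (t t1 t2 a : R) :
    0 <= t -> t1 <= t -> t <= t2 ->
  expR (2 * log_distinct t N) <=
    (num_unimodal n)%:R * expR (- (t * a))
    + expR (2 * log_distinct t1 N - (t - t1) * (n%:R - N%:R))
    + expR (2 * log_distinct t2 N + (t2 - t) * a).
Proof.
move=> t_ge0 t1_le t2_ge.
have WE s : expR (2 * log_distinct s N)
    = \sum_(x : {set 'I_N} * {set 'I_N})
        expR (- (s * (sum_parts x.1 + sum_parts x.2)%:R)) :> R.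
  rewrite -log_tilted0 -sum_expR_parts2; apply: eq_bigr => x _.
  by rewrite mul0r add0r.
rewrite [X in _ + X + _]expRD [X in _ <= _ + X]expRD !WE !mulr_suml.
pose S := [set x : {set 'I_N} * {set 'I_N} |
           (N + (sum_parts x.1 + sum_parts x.2) < n)%N]%SET.
have S_le : \sum_(x in S) expR (- (t * a))
    <= (num_unimodal n)%:R * expR (- (t * a)).
  rewrite sumr_const -[leLHS]mulr_natl ler_wpM2r ?expR_ge0// ler_nat.
  exact: num_unimodal_ge.
rewrite -addrA -big_split/=.
apply: le_trans (lerD S_le (lexx _)).
rewrite [X in _ <= X + _]big_mkcond -big_split/=.
apply: ler_sum => -[A B] _; rewrite inE /=.
move: (sum_parts A + sum_parts B)%N => T.
have e1_ge0 := expR_ge0 (- (t1 * T%:R)).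
rewrite -!expRD.
have [T_lt|T_ge] := ltnP (N + T) n.
  have [a_le|a_gt] := leP a T%:R.
    apply: ler_wpDr; first by rewrite addr_ge0 ?expR_ge0.
    by rewrite ler_expR lerN2 ler_wpM2l.
  apply: ler_wpDl; first by rewrite expR_ge0.
  apply: ler_wpDl; first by rewrite expR_ge0.
  rewrite ler_expR.
  suff : 0 <= (t2 - t) * (a - T%:R) by lra.
  by rewrite mulr_ge0// subr_ge0// ltW.
rewrite add0r; apply: ler_wpDr; first by rewrite expR_ge0.
rewrite ler_expR.
suff : 0 <= (t - t1) * (T%:R - (n%:R - N%:R)) by lra.
by rewrite mulr_ge0 ?subr_ge0// lerBlDl -natrD ler_nat.
Qed.

(** * Growth of the number of unimodal sequences *)

Definition sqrtn {R : realType} (n : nat) : R := Num.sqrt n%:R.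

Lemma sqrtn_ge0 (R : realType) n : 0 <= sqrtn n :> R.
Proof. exact: sqrtr_ge0. Qed.

Lemma sqr_sqrtn (R : realType) n : n%:R = sqrtn n ^+ 2 :> R.
Proof. by rewrite sqr_sqrtr. Qed.

Lemma sqrtn_cvg (R : realType) :
  (sqrtn n : R) @[n --> \oo] --> (+oo : set_system R).
Proof.
apply/cvgryPge => A.
have := @nbhs_infty_ger R (A ^+ 2); apply: filterS => n n_ge.
apply: (le_trans (ler_norm A)); rewrite -sqrtr_sqr.
exact: ler_wsqrtr.
Qed.

Lemma inv_sqrtn_cvg (R : realType) : (sqrtn n : R)^-1 @[n --> \oo] --> (0 : R).
Proof.
apply/gtr0_cvgV0; last exact: sqrtn_cvg.
by exists 1%N => // n /= n_gt0; rewrite sqrtr_gt0 ltr0n.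
Qed.

Lemma log_distinct_sqrt_cvg (R : realType) (c : R) (N : nat -> nat) : 0 < c ->
    (N n)%:R / (sqrtn n : R) @[n --> \oo] --> (+oo : set_system R) ->
  2 * log_distinct (c / sqrtn n) (N n) / (sqrtn n : R) @[n --> \oo]
    --> pi ^+ 2 / 6 / c.
Proof.
move=> c_gt0 Ny.
have -> : pi ^+ 2 / 6 / c = 2 / c * (pi ^+ 2 / 12) by field; rewrite lt0r_neq0.
have -> : (fun n => 2 * log_distinct (c / sqrtn n) (N n) / sqrtn n)
    = (fun n => 2 / c * (c / sqrtn n * log_distinct (c / sqrtn n) (N n))).
  apply/funext => n; rewrite -!mulrA; congr (2 * _).
  by rewrite mulKf ?lt0r_neq0// mulrC.
apply: cvgM; first exact: cvg_cst.
apply: log_distinct_cvg.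
- by move=> n; rewrite divr_ge0 ?sqrtn_ge0// ltW.
- rewrite -(mulr0 c); apply: cvgM; [exact: cvg_cst | exact: inv_sqrtn_cvg].
- have -> : (fun n => c / sqrtn n * (N n)%:R)
      = (fun n => c * ((N n)%:R / sqrtn n)).
    by apply/funext => n; rewrite -mulrA [_^-1 * _]mulrC.
  apply/cvgryPge => A; have /cvgryPge/(_ (A / c)) := Ny; apply: filterS => n.
  by rewrite ler_pdivrMr// mulrC.
Qed.

(** Between terms exp (s * rate) with s tending to infinity only the largest
    rate matters; d leaves room for the constant factors. *)
Lemma expR_dominates (R : realType) (s x y z : nat -> R) (x0 y0 z0 d : R) :
    s n @[n --> \oo] --> +oo ->
    x n @[n --> \oo] --> x0 -> y n @[n --> \oo] --> y0 ->
    z n @[n --> \oo] --> z0 ->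
    y0 < x0 -> z0 < x0 -> 0 < d ->
  \forall n \near \oo,
    expR (s n * (x0 - d)) + expR (s n * y n) + expR (s n * z n)
    <= expR (s n * x n).
Proof.
move=> sy xl yl zl y_lt z_lt d_gt0.
pose e : R := Num.min d (Num.min (x0 - y0) (x0 - z0)) / 3.
have e_gt0 : 0 < e by rewrite divr_gt0// !lt_min !subr_gt0 d_gt0 y_lt z_lt.
have e_d : 3 * e <= d by rewrite /e mulrC divfK// ge_min lexx.
have e_y : 3 * e <= x0 - y0 by rewrite /e mulrC divfK// !ge_min lexx orbT.
have e_z : 3 * e <= x0 - z0 by rewrite /e mulrC divfK// !ge_min lexx !orbT.
clearbody e.
have /cvgrPdist_lt/(_ e e_gt0) xn := xl.
have /cvgrPdist_lt/(_ e e_gt0) yn := yl.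
have /cvgrPdist_lt/(_ e e_gt0) zn := zl.
have /cvgryPge/(_ (2 / e)) sn := sy.
near=> n.
have s_ge : 2 <= s n * e by rewrite -ler_pdivrMr//; near: n.
have s_ge0 : 0 <= s n by rewrite -(pmulr_lge0 _ e_gt0); lra.
have /ltr_normlW xne : `|x0 - x n| < e by near: n.
have : `|y0 - y n| < e by near: n.
rewrite ltr_norml => /andP[yne _].
have : `|z0 - z n| < e by near: n.
rewrite ltr_norml => /andP[zne _].
set E := expR (s n * (x0 - 2 * e)).
have le_E w : w <= x0 - 2 * e -> expR (s n * w) <= E.
  by move=> w_le; rewrite ler_expR ler_wpM2l.
apply: (@le_trans _ _ (3 * E)).
  have -> : 3 * E = E + E + E by ring.
  by rewrite !lerD// le_E//; lra.
apply: (@le_trans _ _ (expR (s n * e) * E)).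
  by rewrite ler_wpM2r ?expR_ge0//; have := expR_ge1Dx (s n * e); lra.
rewrite -expRD ler_expR -mulrDr ler_wpM2l//; lra.
Unshelve. all: by end_near. Qed.

Lemma exists_small (R : realType) (a b : R) : 0 < a -> 0 < b ->
  exists v : R, [/\ 0 < v, v <= 1 / 2 & v * a <= b].
Proof.
move=> a_gt0 b_gt0; have [ab_le|ab_gt] := leP (b / a) (1 / 2).
  by exists (b / a); rewrite divr_gt0// divfK ?lt0r_neq0.
exists (1 / 2); split; [lra | lra |].
by rewrite -ler_pdivlMr//; exact: ltW.
Qed.

(** The constant tau for which the mean size, n (tau / c) ^ 2 at the parameter
    c / sqrt n, is n when c = tau. *)
Definition crit_rate {R : realType} : R := pi / Num.sqrt 6.

Lemma crit_rate_gt0 (R : realType) : 0 < crit_rate :> R.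
Proof. by rewrite divr_gt0 ?pi_gt0 ?sqrtr_gt0. Qed.

Lemma crit_rate_sqr (R : realType) : pi ^+ 2 / 6 = crit_rate ^+ 2 :> R.
Proof. by rewrite expr_div_n sqr_sqrtr. Qed.

(** At the parameter c / sqrt n the typical size is n (tau / c) ^ 2. The
    weight is taken at c = tau / r with r slightly below 1, where the typical
    size r ^ 2 n lies between r ^ 4 n and n. The two Chernoff bounds use the
    parameters whose typical sizes are these two ends, namely tau / r ^ 2 and
    tau. *)
Lemma num_unimodal_growth (R : realType) (k : R) : 0 < k ->
  \forall n \near \oo,
    expR (sqrtn n * (2 * crit_rate - k)) <= (num_unimodal n)%:R.
Proof.
move=> k_gt0.
move: (@crit_rate R) (crit_rate_gt0 R) (crit_rate_sqr R) => tau tau_gt0 tau_sqr.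
pose s : nat -> R := sqrtn.
have s_ge0 n : 0 <= s n by exact: sqrtn_ge0.
have s_sqr n : n%:R = s n ^+ 2 by exact: sqr_sqrtn.
pose rs n : R := Num.sqrt (s n).
have rs_ge0 n : 0 <= rs n by exact: sqrtr_ge0.
have rs_sqr n : rs n ^+ 2 = s n by rewrite sqr_sqrtr.
(* The cutoff n ^ (3/4): large compared with sqrt n, small compared with n. *)
pose N n : nat := Num.truncn (s n * rs n).
have sy : s n @[n --> \oo] --> +oo by exact: sqrtn_cvg.
have s_near1 : \forall n \near \oo, 1 <= s n by have /cvgryPge := sy; exact.
have rs_y : rs n @[n --> \oo] --> +oo.
  apply/cvgryPge => A.
  have /cvgryPge/(_ (A ^+ 2)) := sy; apply: filterS => n n_ge.
  by apply: (le_trans (ler_norm A)); rewrite -sqrtr_sqr ler_wsqrtr.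
have N_le n : (N n)%:R <= s n * rs n.
  by rewrite truncn_le mulr_ge0.
have N_ge n : s n * rs n - 1 <= (N n)%:R.
  have := truncnS_gt (s n * rs n); rewrite -natr1 -/(N n); lra.
have Ny : (N n)%:R / s n @[n --> \oo] --> (+oo : set_system R).
  apply/cvgryPge => A; have /cvgryPge/(_ (A + 1)) := rs_y; move: s_near1.
  apply: filterS2 => n s_ge1 rs_ge.
  rewrite ler_pdivlMr; last by lra.
  apply: le_trans (N_ge n); nra.
have N0 : (N n)%:R / s n ^+ 2 @[n --> \oo] --> (0 : R).
  apply: (@squeeze_cvgr _ _ _ _ (fun=> 0) (fun n => (rs n)^-1)).
  - near=> n; rewrite divr_ge0 ?sqr_ge0//=.
    have s_gt0 : 0 < s n by apply: lt_le_trans ltr01 _; near: n.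
    have rs_gt0 : 0 < rs n by rewrite sqrtr_gt0.
    rewrite ler_pdivrMr ?exprn_gt0// mulrC ler_pdivlMr//.
    apply: (le_trans (ler_wpM2r (ltW rs_gt0) (N_le n))).
    by rewrite -mulrA -expr2 rs_sqr expr2.
  - exact: cvg_cst.
  - apply/gtr0_cvgV0 => //; move: s_near1; apply: filterS => n s_ge1.
    by rewrite sqrtr_gt0; lra.
have [eta [eta_gt0 eta_le eta_k]] :=
  exists_small R _ _ (mulr_gt0 (ltr0n R 8) tau_gt0) k_gt0.
pose r : R := 1 - eta.
have r_gt0 : 0 < r by rewrite /r; lra.
have r_lt1 : r < 1 by rewrite /r; lra.
have r_neq0 := lt0r_neq0 r_gt0.
have L_cvg (c : R) : 0 < c ->
    2 * log_distinct (c / s n) (N n) / s n @[n --> \oo] --> tau ^+ 2 / c.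
  by move=> c_gt0; rewrite -tau_sqr; exact: log_distinct_sqrt_cvg.
(* The rates, per unit of sqrt n, of the total weight and of its two tails;
   convexity makes the tail rates smaller by a multiple of eta ^ 2. *)
pose x n := 2 * log_distinct (tau / r / s n) (N n) / s n.
pose y n := 2 * log_distinct (tau / s n) (N n) / s n
            - tau * (r^-1 - 1) * (1 - (N n)%:R / s n ^+ 2).
pose z n := 2 * log_distinct (tau / r ^+ 2 / s n) (N n) / s n
            + tau * (r^-1 ^+ 2 - r^-1) * r ^+ 4.
have x_cvg : x n @[n --> \oo] --> tau * r.
  have -> : tau * r = tau ^+ 2 / (tau / r).
    by field; rewrite r_neq0 lt0r_neq0.
  by apply: L_cvg; rewrite divr_gt0.
have y_cvg : y n @[n --> \oo] --> tau - tau * (r^-1 - 1) * (1 - 0).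
  apply: cvgB.
    have E : tau ^+ 2 / tau = tau by rewrite expr2 mulfK// lt0r_neq0.
    by rewrite -[X in _ --> X]E; exact: L_cvg.
  apply: cvgM; first exact: cvg_cst.
  by apply: cvgB N0; exact: cvg_cst.
have z_cvg : z n @[n --> \oo]
    --> tau * r ^+ 2 + tau * (r^-1 ^+ 2 - r^-1) * r ^+ 4.
  apply: cvgD; last exact: cvg_cst.
  have -> : tau * r ^+ 2 = tau ^+ 2 / (tau / r ^+ 2).
    by field; rewrite r_neq0 lt0r_neq0.
  by apply: L_cvg; rewrite divr_gt0// exprn_gt0.
have eta2_gt0 : 0 < eta ^+ 2 by rewrite exprn_gt0.
have y_lt : tau - tau * (r^-1 - 1) * (1 - 0) < tau * r.
  have -> : tau - tau * (r^-1 - 1) * (1 - 0) = tau * r - tau * eta ^+ 2 / r.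
    by rewrite /r; field.
  by rewrite ltrBlDr ltrDl divr_gt0// mulr_gt0.
have z_lt : tau * r ^+ 2 + tau * (r^-1 ^+ 2 - r^-1) * r ^+ 4 < tau * r.
  have -> : tau * r ^+ 2 + tau * (r^-1 ^+ 2 - r^-1) * r ^+ 4
      = tau * r - tau * (r * eta ^+ 2).
    by rewrite /r; field.
  by rewrite ltrBlDr ltrDl !mulr_gt0.
have k2_gt0 : 0 < k / 2 by rewrite divr_gt0.
have := expR_dominates R _ _ _ _ _ _ _ _ sy x_cvg y_cvg z_cvg y_lt z_lt k2_gt0.
move: s_near1; apply: filterS2 => n s_ge1 dom.
have s_gt0 : 0 < s n by lra.
have s_neq0 := lt0r_neq0 s_gt0.
have := @num_unimodal_chernoff R n (N n) (tau / r / s n) (tau / s n)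
  (tau / r ^+ 2 / s n) (r ^+ 4 * n%:R).
have rV_ge1 : 1 <= r^-1 by rewrite invf_ge1// ltW.
have -> : 0 <= tau / r / s n by rewrite !divr_ge0// ltW.
have -> : tau / s n <= tau / r / s n.
  by rewrite ler_wpM2r ?invr_ge0// ler_peMr// ltW.
have -> : tau / r / s n <= tau / r ^+ 2 / s n.
  rewrite ler_wpM2r ?invr_ge0// expr2 invfM mulrA ler_peMr//.
  by rewrite divr_ge0// ltW.
move=> /(_ isT isT isT).
have -> : 2 * log_distinct (tau / r / s n) (N n) = s n * x n.
  by rewrite /x [RHS]mulrC divfK.
have -> : 2 * log_distinct (tau / s n) (N n)
    - (tau / r / s n - tau / s n) * (n%:R - (N n)%:R) = s n * y n.
  rewrite (s_sqr n) /y; move: (log_distinct _ _) ((N n)%:R) => l m.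
  by field; rewrite s_neq0 r_neq0.
have -> : 2 * log_distinct (tau / r ^+ 2 / s n) (N n)
    + (tau / r ^+ 2 / s n - tau / r / s n) * (r ^+ 4 * n%:R) = s n * z n.
  rewrite (s_sqr n) /z; move: (log_distinct _ _) => l.
  by field; rewrite s_neq0 r_neq0.
have -> : - (tau / r / s n * (r ^+ 4 * n%:R)) = - (s n * (tau * r ^+ 3)).
  by rewrite (s_sqr n); field; rewrite s_neq0 r_neq0.
move=> chernoff.
have : expR (s n * (tau * r - k / 2))
    <= (num_unimodal n)%:R * expR (- (s n * (tau * r ^+ 3))).
  rewrite -(lerD2r (expR (s n * y n))) -(lerD2r (expR (s n * z n))).
  by rewrite (le_trans dom).
rewrite expRN -ler_pdivrMr ?expR_gt0 ?invr_gt0 ?expR_gt0// invrK -expRD.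
apply: le_trans; rewrite ler_expR -mulrDr ler_wpM2l//.
suff : tau * (2 - r - r ^+ 3) <= k / 2 by lra.
have : 2 - r - r ^+ 3 <= 4 * eta.
  have : 0 <= eta ^+ 2 * (3 - eta) by rewrite mulr_ge0 ?sqr_ge0//; lra.
  by rewrite /r; lra.
by move/(ler_wpM2l (ltW tau_gt0)); lra.
Unshelve. all: by end_near. Qed.

(** * Concentration of the number of parts *)

(** Absorbs the n + 1 possible values of the peak. *)
Lemma natS_le_expR (R : realType) (d : R) : 0 < d ->
  \forall n \near \oo, n.+1%:R <= expR (sqrtn n * d).
Proof.
move=> d_gt0; have /cvgryPge/(_ (6 / d ^+ 3)) := @sqrtn_cvg R.
apply: filterS => n; rewrite ler_pdivrMr ?exprn_gt0// => s_ge.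
have s_ge0 := sqrtn_ge0 R n.
have sd_ge0 : 0 <= sqrtn n * d by rewrite mulr_ge0// ltW.
apply: le_trans (expR_ge1Dxn 2 sd_ge0).
rewrite -natr1 addrC lerD2l (sqr_sqrtn R n) exprMn.
have -> : 3`!%:R = 6 :> R by [].
by rewrite ler_pdivlMr// [sqrtn n ^+ 3]exprSr -[leRHS]mulrA ler_wpM2l ?sqr_ge0.
Qed.

(** The Chernoff bound at the parameter crit_rate / sqrt n, whose exponent is
    read off from the two Riemann sums. *)
Lemma card_unimodal_growth (R : realType) (P : nat -> pred nat) (u Y k : R) :
    (forall n s, P n s -> 0 <= u * (s%:R - sqrtn n * Y)) -> 0 < k ->
  \forall n \near \oo, (card_unimodal n (P n))%:R
    <= expR (sqrtn n * (2 * crit_rate + (expR u - 1) * (2 / crit_rate * ln 2)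
                        - u * Y + k)).
Proof.
move=> uP k_gt0.
move: (@crit_rate R) (crit_rate_gt0 R) (crit_rate_sqr R) => tau tau_gt0 tau_sqr.
pose s : nat -> R := sqrtn.
have s_ge0 n : 0 <= s n by exact: sqrtn_ge0.
have s_sqr n : n%:R = s n ^+ 2 by exact: sqr_sqrtn.
have sy : s n @[n --> \oo] --> +oo by exact: sqrtn_cvg.
have s_near1 : \forall n \near \oo, 1 <= s n by have /cvgryPge := sy; exact.
have sV0 : (s n)^-1 @[n --> \oo] --> (0 : R) by exact: inv_sqrtn_cvg.
have nE n : n%:R / s n = s n.
  rewrite (s_sqr n); have [->|s_neq0] := eqVneq (s n) 0.
    by rewrite invr0 mulr0.
  by rewrite expr2 mulfK.
have L_cvg : 2 * log_distinct (tau / s n) n / s n @[n --> \oo] --> tau.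
  have E : tau ^+ 2 / tau = tau by rewrite expr2 mulfK// lt0r_neq0.
  rewrite -[X in _ --> X]E -tau_sqr.
  by apply: (log_distinct_sqrt_cvg R tau id) => //; under eq_fun do rewrite nE.
pose p n := mean_parts (tau / s n) n.
have p_cvg : 2 / tau * (tau / s n * p n) @[n --> \oo] --> 2 / tau * ln 2.
  apply: cvgM; first exact: cvg_cst.
  apply: (mean_parts_cvg R (fun n => tau / s n) id).
  - by move=> n; rewrite divr_ge0// ltW.
  - by rewrite -(mulr0 tau); apply: cvgM sV0; exact: cvg_cst.
  - have -> : (fun n => tau / s n * n%:R) = (fun n => tau * s n).
      by apply/funext => n; rewrite -mulrA [_^-1 * _]mulrC nE.
    apply/cvgryPge => A.
    have /cvgryPge/(_ (A / tau)) := sy; apply: filterS => n.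
    by rewrite ler_pdivrMr// mulrC.
pose e n := tau + u / s n - u * Y + 2 * log_distinct (tau / s n) n / s n
            + (expR u - 1) * (2 / tau * (tau / s n * p n)).
have e_cvg : e n @[n --> \oo]
    --> tau + u * 0 - u * Y + tau + (expR u - 1) * (2 / tau * ln 2).
  apply: cvgD; last by apply: cvgM p_cvg; exact: cvg_cst.
  apply: cvgD L_cvg; apply: cvgB; last exact: cvg_cst.
  apply: cvgD; first exact: cvg_cst.
  by apply: cvgM sV0; exact: cvg_cst.
have k2_gt0 : 0 < k / 2 by rewrite divr_gt0.
have /cvgrPdist_lt/(_ (k / 2) k2_gt0) e_near := e_cvg.
have n_near := natS_le_expR R _ k2_gt0.
near=> n.
have s_gt0 : 0 < s n by apply: lt_le_trans ltr01 _; near: n.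
have t_ge0 : 0 <= tau / s n by rewrite divr_ge0// ltW.
apply: (le_trans (card_unimodal_chernoff R n (P n) _ _ (s n * Y) t_ge0 (uP n))).
apply: (@le_trans _ _ (expR (s n * (k / 2)) * expR (s n * e n))).
  apply: ler_pM; rewrite ?expR_ge0//; first by near: n.
  rewrite ler_expR.
  have := log_tilted_le R (tau / s n) u n; rewrite -/(p n).
  have -> : s n * e n = tau * s n + u * (1 - s n * Y)
      + 2 * (log_distinct (tau / s n) n + (expR u - 1) * p n).
    rewrite /e; move: (log_distinct _ _) (p n) => l q.
    by field; rewrite !lt0r_neq0.
  have -> : tau / s n * n%:R = tau * s n.
    by rewrite (s_sqr n); field; rewrite lt0r_neq0.
  by move=> l_le; rewrite lerD2l ler_pM2l.
rewrite -expRD ler_expR -mulrDr ler_wpM2l//.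
have : `|tau + u * 0 - u * Y + tau + (expR u - 1) * (2 / tau * ln 2) - e n|
       < k / 2.
  by near: n.
rewrite ltr_norml => /andP[+ _]; move: ((expR u - 1) * _) => q; lra.
Unshelve. all: by end_near. Qed.

(** The bound on exp v comes from exp v = 1 / exp (- v) <= 1 / (1 - v). *)
Lemma expR_quadratic_le (R : realType) (v : R) : 0 <= v -> v <= 1 / 2 ->
  expR v <= 1 + v + 2 * v ^+ 2 /\ expR (- v) <= 1 - v + 2 * v ^+ 2.
Proof.
move=> v_ge0 v_le.
have e1 := expR_ge1Dx v; have e2 := expR_ge1Dx (- v).
have := expRxMexpNx_1 v; have := expR_gt0 v; have := expR_gt0 (- v).
move: (expR v) (expR (- v)) e1 e2 => a b a_ge b_ge b_gt0 a_gt0 ab1.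
split; nra.
Qed.

Theorem corollary1p4 (R : realType) (eps : R) (heps : 0 < eps) :
  ((num_unimodal n)%:R^-1 *
   (num_unimodal_between n
      (Num.sqrt n%:R * (2 * (Num.sqrt 6 / pi) * ln 2 - eps))
      (Num.sqrt n%:R * (2 * (Num.sqrt 6 / pi) * ln 2 + eps)))%:R : R)
    @[n --> \oo] --> (1 : R).
Proof.
pose c : R := 2 / crit_rate * ln 2.
have cE : 2 * (Num.sqrt 6 / pi) * ln 2 = c.
  by rewrite /c /crit_rate invf_div.
have c_gt0 : 0 < c.
  apply: mulr_gt0; last by rewrite ln_gt0// ltr1n.
  by apply: divr_gt0 => //; exact: crit_rate_gt0.
(* A tilt by v gains v * eps and loses at most c * 2 v ^ 2, which this choice
   of v keeps below half of the gain; k is a quarter of the other half. *)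
have [v [v_gt0 v_le v_eps]] :=
  exists_small R _ _ (mulr_gt0 (ltr0n R 4) c_gt0) heps.
have [ev_le eNv_le] := expR_quadratic_le R v (ltW v_gt0) v_le.
pose k : R := v * eps / 8.
have k_gt0 : 0 < k by rewrite divr_gt0// mulr_gt0.
pose hi n : pred nat := fun m => sqrtn n * (c + eps) <= m%:R :> R.
pose lo n : pred nat := fun m => m%:R <= sqrtn n * (c - eps) :> R.
have v_eps_ge : c * (2 * v ^+ 2) <= v * eps / 2.
  by have := ler_wpM2l (ltW v_gt0) v_eps; lra.
have hi_near : \forall n \near \oo,
    (card_unimodal n (hi n))%:R <= expR (sqrtn n * (2 * crit_rate - 3 * k)).
  have uP n m : hi n m -> 0 <= v * (m%:R - sqrtn n * (c + eps)).
    by move=> hi_m; rewrite mulr_ge0 ?subr_ge0// ltW.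
  apply: filterS (card_unimodal_growth R hi v (c + eps) k uP k_gt0) => n.
  move=> /le_trans; apply; rewrite ler_expR ler_wpM2l ?sqrtn_ge0// -/c.
  have := ler_wpM2r (ltW c_gt0) ev_le.
  by rewrite /k; lra.
have lo_near : \forall n \near \oo,
    (card_unimodal n (lo n))%:R <= expR (sqrtn n * (2 * crit_rate - 3 * k)).
  have uP n m : lo n m -> 0 <= - v * (m%:R - sqrtn n * (c - eps)).
    by move=> lo_m; rewrite mulNr -mulrN opprB mulr_ge0 ?subr_ge0// ltW.
  apply: filterS (card_unimodal_growth R lo (- v) (c - eps) k uP k_gt0) => n.
  move=> /le_trans; apply; rewrite ler_expR ler_wpM2l ?sqrtn_ge0// -/c.
  have := ler_wpM2r (ltW c_gt0) eNv_le.
  by rewrite /k; lra.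
have d_near := num_unimodal_growth R k k_gt0.
apply: (@squeeze_cvgr _ _ _ _
  (fun n => 1 - 2 * expR (- (sqrtn n * (2 * k)))) (fun=> 1)).
- near=> n.
  rewrite -/(sqrtn n) cE num_unimodal_betweenE.
  set mid := fun m : nat => _.
  have dE := card_unimodal_predC n mid.
  have d_ge : expR (sqrtn n * (2 * crit_rate - k)) <= (num_unimodal n)%:R.
    by near: n.
  have d_gt0 : 0 < (num_unimodal n)%:R :> R.
    exact: lt_le_trans (expR_gt0 _) d_ge.
  rewrite [_^-1 * _]mulrC ler_pdivrMr// ler_pdivlMr// mul1r ler_nat.
  apply/andP; split; last by rewrite dE leq_addr.
  have tail_le : (card_unimodal n (predC mid)
                  <= card_unimodal n (hi n) + card_unimodal n (lo n))%N.
    rewrite /card_unimodal -count_predUI; apply: leq_trans (leq_addr _ _).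
    apply: sub_count => l /=; rewrite /mid negb_and -!leNgt.
    by rewrite /hi /lo; case/orP => ->; rewrite ?orbT.
  have hi_n : (card_unimodal n (hi n))%:R
      <= expR (sqrtn n * (2 * crit_rate - 3 * k)).
    by near: n.
  have lo_n : (card_unimodal n (lo n))%:R
      <= expR (sqrtn n * (2 * crit_rate - 3 * k)).
    by near: n.
  have tail_n : expR (sqrtn n * (2 * crit_rate - 3 * k))
      <= expR (- (sqrtn n * (2 * k))) * (num_unimodal n)%:R.
    have -> : expR (sqrtn n * (2 * crit_rate - 3 * k))
        = expR (- (sqrtn n * (2 * k))) * expR (sqrtn n * (2 * crit_rate - k)).
      by rewrite -expRD; congr expR; ring.
    by rewrite ler_wpM2l ?expR_ge0.
  move: tail_le; rewrite -(ler_nat R) natrD.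
  have : (num_unimodal n)%:R
      = (card_unimodal n mid)%:R + (card_unimodal n (predC mid))%:R :> R.
    by rewrite -natrD -dE.
  move: hi_n lo_n tail_n; move: (num_unimodal n)%:R => d.
  move: (card_unimodal n mid)%:R (card_unimodal n (predC mid))%:R => g b.
  move: (card_unimodal n (hi n))%:R (card_unimodal n (lo n))%:R => h l.
  move: (expR _) (expR _) => E1 E2.
  lra.
- rewrite -[X in _ --> X]subr0 -(mulr0 2); apply: cvgB; first exact: cvg_cst.
  apply: cvgM; first exact: cvg_cst.
  apply: (cvg_comp (fun n => sqrtn n * (2 * k)) (fun y => expR (- y)) _
            (@cvgr_expR R)).
  apply/cvgryPge => A; have /cvgryPge/(_ (A / (2 * k))) := @sqrtn_cvg R.
  by apply: filterS => n; rewrite ler_pdivrMr// mulr_gt0.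
- exact: cvg_cst.
Unshelve. all: by end_near. Qed.
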